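(* Let $G$ be a graph and let $e\in E(G)$ be an edge. If $k:=\mathrm{gir}_e(G)\in[5,\infty)$, then $\mathrm{MH}_{2,\ell}(G)\ne 0$ for $\ell=\left\lfloor\frac{k+1}{2}\right\rfloor$.
   Context: A graph means a finite simple undirected graph without loops, with nonempty vertex set $V(G)$ and edge set $E(G)$ (not necessarily connected). An $i$-cycle ($i\ge 3$) in $G$ is a tuple $(x_0,\dots,x_i)$ of vertices with $\{x_k,x_{k+1}\}\in E(G)$ for $0\le k\le i-1$, $x_0=x_i$, and $x_0,\dots,x_{i-1}$ all distinct. The local girth at an edge $e$ is $\mathrm{gir}_e(G)=\inf\{i\ge3 \mid \text{there is an } i\text{-cycle in } G \text{ containing } e \text{ as one of its edges}\}$, with $\inf\emptyset=\infty$. Let $d(x,y)$ be the length of a shortest path between $x$ and $y$ ($\infty$ if there is none), and $L(x_0,\dots,x_k)=\sum_{i=1}^k d(x_{i-1},x_i)$. For integers $k,\ell\ge 0$, $\mathrm{MC}_{k,\ell}(G)$ is the free $\mathbb{Z}$-module generated by the tuples $(x_0,\dots,x_k)\in V(G)^{k+1}$ with $x_{i-1}\ne x_i$ for all $1\le i\le k$ and $L(x_0,\dots,x_k)=\ell$; $\mathrm{MC}_{-1,\ell}(G)=0$. The boundary map $\partial_{k,\ell}:\mathrm{MC}_{k,\ell}(G)\to\mathrm{MC}_{k-1,\ell}(G)$ is given for $k\ge1$ by $\partial_{k,\ell}(x_0,\dots,x_k)=\sum_{i} (-1)^i (x_0,\dots,\hat{x}_i,\dots,x_k)$, the sum over those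 $1\le i\le k-1$ with $d(x_{i-1},x_{i+1})=d(x_{i-1},x_i)+d(x_i,x_{i+1})$ (the hat means deletion), and $\partial_{0,\ell}=0$. The magnitude homology is $\mathrm{MH}_{k,\ell}(G)=\ker\partial_{k,\ell}/\mathrm{Im}\,\partial_{k+1,\ell}$. *)

(* Defs.v *)
From HB Require Import structures.
From mathcomp Require Import all_boot all_order all_algebra.
From mathcomp Require Import boolp.

Set Implicit Arguments.
Unset Strict Implicit.
Unset Printing Implicit Defensive.

Import GRing.Theory.
Local Open Scope ring_scope.

Record sgraph := SGraph {
  vertex :> finType;
  adj : rel vertex;
  adj_sym : symmetric adj;
  adj_irrefl : irreflexive adj;
  vertex_nonempty : (0 < #|vertex|)%N
}.

Definition edges (G : sgraph) : {set {set G}} :=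
  [set [set u; v] | u in G, v in G & adj u v].

(* [enat] is nat with a point at infinity, encoded as [None]. *)
Notation enat := (option nat).

Definition eadd (m n : enat) : enat :=
  if m is Some a then if n is Some b then Some (a + b)%N else None else None.

Definition einf (P : pred nat) : enat :=
  if pselect (exists n, P n) is left exP then Some (ex_minn exP) else None.

Section Graph.
Variable G : sgraph.

(* An i-cycle (x_0, ..., x_i) is represented by c = [:: x_0; ...; x_(i-1)]:
   the final vertex x_i = x_0 is left implicit, as usual for [cycle]. *)
Definition is_cycle (i : nat) (c : i.-tuple G) : bool :=
  (3 <= i)%N && ucycleb (@adj G) c.

Definition edge_in_cycle (e : {set G}) (c : seq G) : bool :=
  has (fun x => [set x; next c x] == e) c.

Definition local_girth (e : {set G}) : enat :=
  einf (fun i => [exists c : i.-tuple G, is_cycle c && edge_in_cycle e c]).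

Definition dist (x y : G) : enat :=
  einf (fun n => [exists p : n.-tuple G,
    [&& path (@adj G) x p, uniq (x :: p) & last x p == y]]).

Definition tuple_length (s : seq G) : enat :=
  if s is x :: p then foldr eadd (Some 0%N) (pairmap dist x p) else Some 0%N.

Definition is_chain (k l : nat) (x : k.+1.-tuple G) : bool :=
  sorted (fun u v => u != v) x && (tuple_length x == Some l).

Definition gen (k l : nat) : finType := {x : k.+1.-tuple G | is_chain l x}.

(* The free Z-module on the finite set [gen k l]. *)
Definition MC (k l : nat) : zmodType := {ffun gen k l -> int}.

(* The basis vector attached to s, for s the underlying sequence of an element
   of [gen k l]. *)
Definition basis (k l : nat) (s : seq G) : MC k l :=
  [ffun y : gen k l => (s == val y :> seq G)%:R].

Definition delete (i : nat) (s : seq G) : seq G := take i s ++ drop i.+1 s.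

Definition smooth (k : nat) (x : k.+1.-tuple G) (i : nat) : bool :=
  let v j := tnth x (inord j) in
  dist (v i.-1) (v i.+1) == eadd (dist (v i.-1) (v i)) (dist (v i) (v i.+1)).

Definition boundary_gen (k l : nat) (x : gen k l) : MC k.-1 l :=
  \sum_(1 <= i < k | smooth (val x) i)
     basis k.-1 l (delete i (val x)) *~ (-1) ^+ i.

(* For k = 0 the sum in [boundary_gen] is empty, so this is the zero map; its
   codomain is then MC 0 l instead of MC (-1) l = 0, with the same kernel. *)
Definition boundary (k l : nat) (f : MC k l) : MC k.-1 l :=
  \sum_(x : gen k l) boundary_gen x *~ f x.

Lemma boundary_is_additive k l : zmod_morphism (@boundary k l).
Proof.
move=> f g; rewrite /boundary -sumrB; apply: eq_bigr => x _.
by rewrite !ffunE mulrzBr.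
Qed.

HB.instance Definition _ k l :=
  GRing.isZmodMorphism.Build (MC k l) (MC k.-1 l) (@boundary k l)
    (@boundary_is_additive k l).

Lemma eaddA : associative eadd.
Proof. by case=> [a|] [b|] [c|] //=; rewrite addnA. Qed.

Lemma dist_eq0 x y : (dist x y == Some 0%N) = (x == y).
Proof.
rewrite /dist /einf; case: pselect => [exP|nP] /=; last first.
  apply/esym/negbTE/eqP => xy; apply: nP; exists 0%N.
  by apply/existsP; exists [tuple]; rewrite /= xy eqxx.
case: ex_minnP => m /existsP[p /and3P[_ _ /eqP pl]] mmin.
rewrite -[Some m == _]/(m == 0%N); apply/eqP/eqP => [m0|xy].
  by case: m p pl mmin m0 => // p; rewrite tuple0.
apply/eqP; rewrite -leqn0; apply: mmin; apply/existsP; exists [tuple].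
by rewrite /= xy eqxx.
Qed.

Lemma smooth_neq (x y z : G) :
  dist x z = eadd (dist x y) (dist y z) -> x != y -> x != z.
Proof.
move=> xyz; apply: contraNneq => xz.
move: xyz; rewrite -xz -dist_eq0.
have /eqP -> : dist x x == Some 0%N by rewrite dist_eq0.
by case: (dist x y) => [[]|] //; case: (dist y x).
Qed.

(* The deleted tuples occurring in [boundary_gen] are generators, so that
   [basis] is only ever applied to generators. *)
Lemma delete_is_chain k l (x : gen k l) (i : nat) :
  (0 < i < k)%N -> smooth (val x) i ->
  exists y : gen k.-1 l, val y = delete i (val x) :> seq G.
Proof.
case: x => /= x; rewrite /is_chain => /andP[xne /eqP xl] /andP[i0 ik] sm.
have szx : size x = k.+1 by rewrite size_tuple.
pose v j := tnth x (inord j).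
have vE j : (j <= k)%N -> v j = nth (v 0) x j.
  by move=> jk; rewrite /v (tnth_nth (v 0%N)) inordK.
have xE : x = take i.-1 x ++ [:: v i.-1, v i, v i.+1 & drop i.+2 x] :> seq G.
  have i1k : (i.-1 <= k)%N by rewrite (leq_trans (leq_pred _)) // ltnW.
  rewrite -{1}(cat_take_drop i.-1 x); congr cat.
  rewrite (drop_nth (v 0%N)) ?szx // -vE // prednK //.
  rewrite (drop_nth (v 0%N)) ?szx ?ltnS 1?ltnW // -vE 1?ltnW //.
  by rewrite (drop_nth (v 0%N)) ?szx // -vE.
have dE : delete i x = take i.-1 x ++ [:: v i.-1, v i.+1 & drop i.+2 x].
  rewrite /delete -{1}(prednK i0) (take_nth (v 0%N)) ?szx; last first.
    by rewrite prednK // ltnW // ltnW.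
  rewrite (drop_nth (v 0%N)) ?szx // -!vE //.
    by rewrite cat_rcons.
  by rewrite (leq_trans (leq_pred _)) // ltnW.
have szd : size (delete i x) == k.-1.+1.
  have := congr1 size xE; rewrite dE !size_cat /= size_tuple !addnS => -[<-].
  by rewrite prednK // (leq_ltn_trans _ ik).
move: sm; rewrite /smooth -!/(v _) => /eqP sm.
set p := take i.-1 x in xE dE.
set q := drop i.+2 x in xE dE.
have [lE ne] : tuple_length (delete i x) = Some l /\
   sorted (fun u v => u != v) (delete i x).
  move: xne xl; rewrite dE xE; case: (p) => [|y p'] /=.
    move=> /and3P[ab bc qP]; rewrite eaddA -sm => dl; split=> //.
    by rewrite qP andbT; apply: smooth_neq sm ab.
  rewrite !cat_path !pairmap_cat !foldr_cat /= (eaddA (dist (v i.-1) _)) -sm.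
  move=> /and5P[-> -> ab bc ->] dl; split=> //=; rewrite andbT.
  by apply: smooth_neq sm ab.
suff cP : is_chain l (Tuple szd) by exists (Sub (Tuple szd) cP).
by rewrite /is_chain /= lE ne eqxx.
Qed.

Section Homology.
Variables k l : nat.

Definition cycle_pred : {pred MC k l} := [pred f | boundary f == 0].

Lemma cycle_pred_closed : zmod_closed cycle_pred.
Proof.
split=> [|f g]; rewrite !inE ?raddf0 // => /eqP f0 /eqP g0.
by rewrite raddfB /= f0 g0 subr0.
Qed.

HB.instance Definition _ :=
  GRing.isZmodClosed.Build (MC k l) cycle_pred cycle_pred_closed.

Record cycles := Cycles { cycles_val :> MC k l; _ : cycles_val \in cycle_pred }.

HB.instance Definition _ := [isSub for cycles_val].
HB.instance Definition _ := [Choice of cycles by <:].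
HB.instance Definition _ := [SubChoice_isSubZmodule of cycles by <:].

(* The cycles lying in the image of [boundary k.+1 l]; as boundary \o boundary
   vanishes on magnitude chains, this is the whole image. *)
Definition boundaries : {pred cycles} :=
  [pred z : cycles | `[< exists w : MC k.+1 l, boundary w = val z >]].

Lemma boundaries_closed : zmod_closed boundaries.
Proof.
split=> [|f g]; rewrite !inE.
  by apply/asboolP; exists 0; rewrite !raddf0.
move=> /asboolP[u fu] /asboolP[v gv]; apply/asboolP; exists (u - v).
by rewrite !raddfB /= fu gv.
Qed.

HB.instance Definition _ :=
  GRing.isZmodClosed.Build cycles boundaries boundaries_closed.

Definition MH : zmodType := Quotient.quot boundaries.

End Homology.
End Graph.

(* Main.v *)
(* Let e = uv and n = floor((k-1)/2), so that l = n + 1. A shortest path from u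
   to v avoiding e has length k - 1; together with e it is an isometric k-cycle,
   so it carries a vertex b with d(v,b) = n and d(u,b) = k - 1 - n, that is, n
   (k odd) or n + 1 (k even).  Let phi add up the coefficients of the chains
   (u,y,b) such that y != b, d(u,y) = 1 + d(v,y) and d(v,y) + d(y,b) = n.  For a
   3-chain (u,y,w,b) of length n + 1, its two faces are counted by phi or not
   simultaneously: otherwise two geodesics from u and v to a common vertex at
   distance less than n from v would close up with e to a cycle shorter than k.
   Hence phi kills boundaries.  Finally phi is 1 on the chain (u,v,b), which is a
   cycle if k is odd; if k is even, subtract (u,x,b) with x the neighbour of u on
   the other geodesic to b, on which phi vanishes. *)

From HB Require Import structures.
Require Import Defs.
From mathcomp Require Import all_boot all_order all_algebra.
From mathcomp Require Import boolp zify.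

Set Implicit Arguments.
Unset Strict Implicit.
Unset Printing Implicit Defensive.

Import GRing.Theory.

(** * Walks of bounded length *)

(** Bounding the length instead of fixing it makes walks monotone in [n]; allowing repeated vertices
    lets them be concatenated without pruning. *)
Definition walk (T : eqType) (r : rel T) (n : nat) (x y : T) : Prop :=
  exists p, [/\ path r x p, last x p = y & size p <= n].

Section Walks.
Variables (T : eqType) (r : rel T).

Lemma walk_leq m n x y : m <= n -> walk r m x y -> walk r n x y.
Proof. by move=> mn [p [? ? /leq_trans/(_ mn)]]; exists p. Qed.

Lemma walk_cat m n x y z : walk r m x y -> walk r n y z -> walk r (m + n) x z.
Proof.
move=> [p [xp py pm]] [q [yq qz qn]]; exists (p ++ q).
by rewrite cat_path last_cat size_cat py xp yq leq_add.
Qed.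

Lemma walk_sym m x y : symmetric r -> walk r m x y -> walk r m y x.
Proof.
move=> rC [p [xp py pm]]; exists (rev (belast x p)).
rewrite size_rev size_belast; split=> //; last first.
  by rewrite -[x]/(last y [:: x]) -py; case: (p) => //= z q; rewrite rev_cons last_rcons.
by rewrite -py rev_path (eq_path (e' := r)).
Qed.

Lemma walk_sub (s : rel T) m x y : subrel r s -> walk r m x y -> walk s m x y.
Proof. by move=> rs [p [xp ? ?]]; exists p; rewrite (sub_path rs). Qed.

Lemma walk_split m n x y : walk r (m + n) x y ->
  exists2 z, walk r m x z & walk r n z y.
Proof.
move=> [p [xp py pmn]].
move: xp py; rewrite -{1 2}(cat_take_drop m p) cat_path last_cat.
move=> /andP[xp yp] py; exists (last x (take m p)).
  by exists (take m p); rewrite size_take_min geq_minl.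
by exists (drop m p); rewrite size_drop leq_subLR.
Qed.

End Walks.

(** * Graph distance and walks that avoid an edge *)

Section Distance.
Variable G : sgraph.
Implicit Types x y z : G.

(** [dist] minimises over paths without repetition; pruning the repetitions of a walk never
    lengthens it, so walks have the same minimum. *)
Lemma distP x y n : dist x y = Some n ->
  walk (@adj G) n x y /\ forall m, walk (@adj G) m x y -> n <= m.
Proof.
rewrite /dist /einf; case: pselect => // exP [<-].
case: ex_minnP => {}n /existsP[p /and3P[xp _ /eqP py]] nmin; split.
  by exists p; rewrite size_tuple.
move=> m [q [xq qy qm]]; case: (shortenP xq) qy => q' xq' uq' sq' q'y.
have q'q : size q' <= size q by apply: uniq_leq_size sq'; case/andP: uq'.
apply: leq_trans (leq_trans q'q qm); apply: nmin; apply/existsP.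
by exists (in_tuple q'); rewrite /= xq' q'y eqxx andbT; move: uq' => /= ->.
Qed.

Lemma walk_dist x y m : walk (@adj G) m x y ->
  exists2 n, dist x y = Some n & n <= m.
Proof.
move=> w; case E: (dist x y) => [n|].
  by exists n => //; case: (distP E) => _; apply.
move: w E => [q [xq qy _]]; rewrite /dist /einf; case: pselect => // nP _; case: nP.
case: (shortenP xq) qy => q' xq' uq' _ q'y; exists (size q'); apply/existsP.
by exists (in_tuple q'); rewrite /= xq' q'y eqxx andbT; move: uq' => /= ->.
Qed.

Lemma dist_walk x y n : dist x y = Some n -> walk (@adj G) n x y.
Proof. by case/distP. Qed.

Lemma dist_min x y n m : dist x y = Some n -> walk (@adj G) m x y -> n <= m.
Proof. by case/distP => _; apply. Qed.

Lemma distxx x : dist x x = Some 0.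
Proof. by apply/eqP; rewrite dist_eq0. Qed.

Lemma distC x y : dist x y = dist y x.
Proof.
have wC m a b := @walk_sym _ _ m a b (@adj_sym G).
case E: (dist x y) => [n|]; case F: (dist y x) => [m|] //.
- congr Some; apply/eqP; rewrite eqn_leq.
  by rewrite (dist_min E (wC _ _ _ (dist_walk F))) (dist_min F (wC _ _ _ (dist_walk E))).
- by have [k] := walk_dist (wC _ _ _ (dist_walk E)); rewrite F.
- by have [k] := walk_dist (wC _ _ _ (dist_walk F)); rewrite E.
Qed.

Lemma dist_triangle x y z m n : dist x y = Some m -> dist y z = Some n ->
  exists2 k, dist x z = Some k & k <= m + n.
Proof. by move=> /dist_walk xy /dist_walk yz; apply/walk_dist/(walk_cat xy yz). Qed.

Lemma dist_adj x y : adj x y -> dist x y = Some 1.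
Proof.
move=> xy; have [|[|[|//]] E _] := @walk_dist x y 1; last by [].
  by exists [:: y]; rewrite /= xy.
by move/eqP: E; rewrite dist_eq0 => /eqP E; rewrite E adj_irrefl in xy.
Qed.

Lemma dist_gt0 x y n : dist x y = Some n -> x != y -> 0 < n.
Proof. by case: n => // /eqP; rewrite dist_eq0 => ->. Qed.

Definition avoid (e : {set G}) : rel G := fun x y => adj x y && ([set x; y] != e).

Lemma avoid_sym e : symmetric (avoid e).
Proof. by move=> x y; rewrite /avoid adj_sym setUC. Qed.

Lemma avoid_sub e : subrel (avoid e) (@adj G).
Proof. by move=> x y /andP[]. Qed.

Lemma set2_inj x y u v : [set x; y] = [set u; v] ->
  (x = u /\ y = v) \/ (x = v /\ y = u).
Proof.
move=> E; have: (x \in [set u; v]) && (y \in [set u; v]).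
  by rewrite -E !inE !eqxx orbT.
have: (u \in [set x; y]) && (v \in [set x; y]) by rewrite E !inE !eqxx orbT.
rewrite !inE => /andP[/orP[]/eqP-> /orP[]/eqP->] /andP[/orP[]/eqP E1 /orP[]/eqP E2];
  by rewrite ?E1 ?E2; auto.
Qed.

Lemma path_avoid x y a (q : seq G) : path (@adj G) a q ->
  x \notin q -> y \notin q -> path (avoid [set x; y]) a q.
Proof.
elim: q a => //= c q IH a /andP[ac cq].
rewrite !inE !negb_or => /andP[xc xq] /andP[yc yq]; rewrite IH // andbT /avoid ac /=.
apply/eqP => /set2_inj [] [_ E]; by [case/eqP: yc|case/eqP: xc].
Qed.

(* Cut the walk after its last passage through the edge uv. *)
Lemma walk_avoid u v m x w : walk (@adj G) m x w ->
  walk (avoid [set u; v]) m x w \/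
  (exists2 j, j < m &
     walk (avoid [set u; v]) j u w \/ walk (avoid [set u; v]) j v w).
Proof.
move=> [p]; elim: p x m => [|y p IH] x m [xp pw pm].
  by left; exists [::].
case: m pm => // m pm; move: xp => /= /andP[xy yp].
have [[q [yq qw qm]]|[j jm H]] := IH y m (And3 yp pw pm); last first.
  by right; exists j => //; lia.
case: (boolP (avoid [set u; v] x y)) => [exy|].
  by left; exists (y :: q); rewrite /= exy.
rewrite /avoid xy negbK => /eqP /set2_inj [[_ yE]|[_ yE]]; right; exists m => //;
  subst y; [right|left]; by exists q.
Qed.

End Distance.

(** * Geodesics from the two ends of an edge that lies on no short cycle *)

Section Girth.
Variables (G : sgraph) (u v : G) (n : nat).
Hypothesis uv : adj u v.
Let r := avoid [set u; v].
Hypothesis girth : forall m, walk r m u v -> 2 * n <= m.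

Let rC : symmetric r := avoid_sym _.
Let adjC m x y : walk r m x y -> walk (@adj G) m x y := walk_sub (@avoid_sub G _).
Let dvu : dist v u = Some 1 := dist_adj (etrans (adj_sym v u) uv).
Let duv : dist u v = Some 1 := dist_adj uv.

(* The two geodesics cannot both have length j < n: joined with the edge uv
   they would contain a closed walk through uv of length 2j + 1. *)
Lemma dist_far_end w i j : dist v w = Some j -> dist u w = Some i ->
  j < n -> j <= i -> i = j.+1.
Proof.
move=> vw uw jn ji; have [k] := dist_triangle duv vw; rewrite uw => -[<-{k}] ij.
suff ine : i <> j by lia.
move=> eij; subst i.
have wuw : walk r j u w.
  have [//|[k kj [H|H]]] := walk_avoid u v (dist_walk uw).
    exact: walk_leq (ltnW kj) H.
  by have := dist_min vw (adjC H); lia.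
have wvw : walk r j v w.
  have [//|[k kj [H|H]]] := walk_avoid u v (dist_walk vw).
    by have := dist_min uw (adjC H); lia.
  exact: walk_leq (ltnW kj) H.
have := girth (walk_cat wuw (walk_sym rC wvw)); lia.
Qed.

(** If a geodesic from [u] to [y] avoided the edge uv, so would geodesics from [y] to [w] and from
    [v] to [w]; joined, they would be a walk from [u] to [v] of length 2j + 1 < 2n. So it uses the
    edge, and its part after [v] has length at most a - 1. *)
Lemma dist_on_geodesic y w a c j : 0 < a ->
  dist u y = Some a -> dist y w = Some c -> dist u w = Some (a + c) ->
  dist v w = Some j -> a + c = j.+1 -> j < n -> dist v y = Some a.-1.
Proof.
move=> a0 uy yw uw vw acj jn.
have [k vy ka] := dist_triangle dvu uy.
have [k'] := dist_triangle duv vy; rewrite uy => -[<-{k'}] ak.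
have [H|[i ia [H|H]]] := walk_avoid u v (dist_walk uy); first last.
- by have := dist_min vy (adjC H); rewrite vy => ?; congr Some; lia.
- by have := dist_min uy (adjC H); lia.
have wyw : walk r c y w.
  have [//|[i ia [H'|H']]] := walk_avoid u v (dist_walk yw).
    by have := dist_min uw (adjC H'); lia.
  by have := dist_min vw (adjC H'); lia.
have wvw : walk r j v w.
  have [//|[i ij [H'|H']]] := walk_avoid u v (dist_walk vw).
    by have := dist_min uw (adjC H'); lia.
  exact: walk_leq (ltnW ij) H'.
have := girth (walk_cat (walk_cat H wyw) (walk_sym rC wvw)); lia.
Qed.

Variable b : G.

(* For n = d(v, b) these are the y such that [u, v, ..., y, ..., b] is a path of
   length n + 1 with geodesic parts from u to y and from v to b. *)
Definition beyond (y : G) : bool :=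
  [&& y != b, dist u y == eadd (Some 1) (dist v y)
    & eadd (dist v y) (dist y b) == Some n].

Hypothesis vb : dist v b = Some n.
Variable m : nat.
Hypotheses (ub : dist u b = Some m) (nm : n <= m).

Lemma beyond_smooth y w : u != y -> y != w -> w != b ->
  eadd (dist u y) (eadd (dist y w) (dist w b)) = Some n.+1 ->
  (dist y b == eadd (dist y w) (dist w b)) && beyond y =
  (dist u w == eadd (dist u y) (dist y w)) && beyond w.
Proof.
move=> uNy yNw wNb.
case uy: (dist u y) => [a|] //; case yw: (dist y w) => [c|] //.
case wb: (dist w b) => [d|] //= -[acd].
have a0 := dist_gt0 uy uNy; have c0 := dist_gt0 yw yNw; have d0 := dist_gt0 wb wNb.
rewrite /beyond wNb /= uy wb.
have [p vy _] := dist_triangle dvu uy.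
have [q vw ql] := dist_triangle vy yw.
have [s uw sl] := dist_triangle uy yw.
have [t yb tl] := dist_triangle yw wb.
rewrite vy vw uw yb /=.
have [k] := dist_triangle duv vy; rewrite uy => -[<-{k}] ap.
have [k] := dist_triangle dvu uy; rewrite vy => -[<-{k}] pa.
have [k] := dist_triangle vy yb; rewrite vb => -[<-{k}] npt.
have [k] := dist_triangle vw wb; rewrite vb => -[<-{k}] nqd.
have [k] := dist_triangle uw wb; rewrite ub => -[<-{k}] msd.
(* If y = b then a = m >= n, whereas c, d >= 1 force a < n. *)
have yNb : y != b.
  apply/eqP=> E; move: uy yw; rewrite E ub distC wb => -[am] [dc]; lia.
rewrite yNb /= -![Some _ == Some _]/(_ == _ :> nat).
apply/idP/idP.
  (* The triangle inequality n <= q + d forces q = p + c; [dist_far_end] then applies, with q <= s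
     coming from n <= m <= s + d. *)
  move=> /and3P[/eqP tE /eqP aE /eqP pt].
  have qE : q = p + c by lia.
  have := dist_far_end vw uw; lia.
(* Conversely, [dist_on_geodesic] gives p = a - 1, and n <= p + t then forces t = c + d. *)
move=> /and3P[/eqP sE /eqP sq /eqP qd].
have uw' := uw; rewrite sE in uw'.
have := @dist_on_geodesic y w a c q a0 uy yw uw' vw; rewrite vy => H.
have [] : Some p = Some a.-1 by apply: H; lia.
lia.
Qed.

End Girth.

(** * Detecting homology classes by a linear functional *)

Section Detection.
Variables (G : sgraph) (l : nat).
Local Open Scope ring_scope.

(** The predicate is on bare sequences, so that it can be evaluated on a face [delete i x] without a
    proof that the face is a chain. *)
Definition coef_sum k (P : pred (seq G)) (f : MC G k l) : int :=
  \sum_(x : gen G k l | P (val x)) f x.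

Lemma coef_sum_is_additive k P : zmod_morphism (@coef_sum k P).
Proof.
by move=> f g; rewrite /coef_sum -sumrB; apply: eq_bigr => x _; rewrite !ffunE.
Qed.

HB.instance Definition _ k P :=
  GRing.isZmodMorphism.Build (MC G k l) int (@coef_sum k P)
    (@coef_sum_is_additive k P).

Lemma coef_sum_basis k P (y : gen G k l) :
  coef_sum P (basis k l (val y)) = (P (val y))%:R.
Proof.
rewrite /coef_sum (eq_bigr (fun x => if x == y then 1 else 0)); last first.
  by move=> x _; rewrite ffunE eq_sym (inj_eq val_inj) (inj_eq val_inj); case: eqP.
rewrite big_mkcond (bigD1 y) //= eqxx big1 ?addr0; first by case: (P _).
by move=> x /negbTE ->; case: (P _).
Qed.

Lemma boundary_basis k (y : gen G k l) :
  boundary (basis k l (val y)) = boundary_gen y.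
Proof.
rewrite /boundary (bigD1 y) //= ffunE eqxx mulr1z big1 ?addr0 // => x xy.
by rewrite ffunE (inj_eq val_inj) (inj_eq val_inj) eq_sym (negbTE xy) mulr0z.
Qed.

Lemma boundary_gen2 (x : gen G 2 l) : boundary_gen x =
  if smooth (val x) 1 then - basis 1 l (delete 1 (val x)) else 0.
Proof. rewrite /boundary_gen big_mkcond big_nat1 expr1 mulrNz mulr1z; exact: erefl. Qed.

Lemma boundary_gen3 (x : gen G 3 l) : boundary_gen x =
  (if smooth (val x) 2 then basis 2 l (delete 2 (val x)) else 0) -
  (if smooth (val x) 1 then basis 2 l (delete 1 (val x)) else 0).
Proof.
rewrite /boundary_gen big_mkcond big_nat_recl // big_nat1 /= addrC.
rewrite sqrrN expr1n expr1 mulrNz !mulr1z (fun_if -%R) oppr0; exact: erefl.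
Qed.

Lemma coef_sum_boundary (P : pred (seq G)) (w : MC G 3 l) :
  (forall x : gen G 3 l, smooth (val x) 1 && P (delete 1 (val x)) =
                         smooth (val x) 2 && P (delete 2 (val x))) ->
  coef_sum P (boundary w : MC G 2 l) = 0.
Proof.
move=> HP; rewrite /boundary raddf_sum big1 // => x _.
rewrite raddfMz boundary_gen3 raddfB /=.
have E i : (0 < i < 3)%N ->
    coef_sum P (if smooth (val x) i then basis 2 l (delete i (val x)) else 0) =
    (smooth (val x) i && P (delete i (val x)))%:R.
  move=> i3; case: ifP => [sm|_]; last by rewrite raddf0.
  have [y yE] := delete_is_chain i3 sm.
  by rewrite -yE coef_sum_basis.
by rewrite !E // HP subrr mul0rz.
Qed.

(** A functional that vanishes on boundaries descends to homology, so a nonzero value on a cycle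
    certifies a nonzero class. *)
Lemma MH2_neq0 (P : pred (seq G)) (z : MC G 2 l) :
  (forall x : gen G 3 l, smooth (val x) 1 && P (delete 1 (val x)) =
                         smooth (val x) 2 && P (delete 2 (val x))) ->
  boundary z = 0 -> coef_sum P z != 0 -> exists h : MH G 2 l, h <> 0.
Proof.
move=> HP /eqP z0 Pz.
pose c : cycles G 2 l := Cycles (z0 : z \in @cycle_pred G 2 l).
exists (\pi_(MH G 2 l)%qT c) => /eqP.
rewrite -[X in _ == X]/(0 : MH G 2 l).
have -> : (0 : MH G 2 l) = \pi_(MH G 2 l)%qT 0 by rewrite raddf0.
rewrite -Quotient.idealrBE subr0 => /asboolP[w wz].
by case/eqP: Pz; rewrite -(coef_sum_boundary w HP) wz.
Qed.

End Detection.

(** * From the local girth to distances along a shortest cycle *)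

(** Cutting a cycle at [e] leaves a path avoiding [e], and closing such a path with [e] gives back a
    cycle; so k - 1 is the distance from [u] to [v] once [e] is removed. *)
Lemma local_girthP (G : sgraph) (e : {set G}) k : local_girth e = Some k ->
  exists u v : G, [/\ e = [set u; v], adj u v, walk (avoid e) k.-1 u v &
    forall m, walk (avoid e) m u v -> k.-1 <= m].
Proof.
rewrite /local_girth /einf; case: pselect => // exP [<-] {k}.
case: ex_minnP => k /existsP[c /andP[/andP[k3 /andP[cc uc]] /hasP[v vc /eqP ve]]] kmin.
(* Rotate the cycle to start at [v], so that [e] joins its first two vertices. *)
have [i q cq] := rot_to vc.
have sq : (size q).+1 = k by have := size_rot i c; rewrite cq size_tuple.
move: ve; rewrite -(next_rot i uc) cq; rewrite -(rot_cycle i) cq in cc.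
rewrite -(rot_uniq i) cq in uc.
case: q sq uc cc {cq} => [|u q] sq; first by rewrite -sq in k3.
rewrite /= eqxx => /and3P[vq uq _] /andP[vu pq] ve.
have uv : adj u v by rewrite adj_sym.
exists u, v; rewrite -ve setUC; split=> //.
  exists (rcons q v); rewrite last_rcons size_rcons -sq; split=> //.
  move: vq; rewrite inE negb_or => /andP[vNu vq].
  move: pq; rewrite !rcons_path => /andP[pq lv]; rewrite path_avoid //= /avoid lv /=.
  (* The closing edge into [v] is not [e]: as k >= 3, the last vertex of the cycle is neither [u]
     nor [v]. *)
  case: q sq uq vq lv pq => [|a q]; first by move=> sq; rewrite -sq in k3.
  move=> _ uq vq _ _; apply/eqP => /set2_inj[] [E _].
    by move: uq; rewrite -[X in X \notin _]E /= mem_last.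
  by move: vq; rewrite -[X in X \notin _]E /= mem_last.
move=> m [p [up pv pm]]; case: (shortenP up) pv => p' up' uq' sp' p'v.
have pp : size p' <= size p by apply: uniq_leq_size sp'; case/andP: uq'.
suff : k <= (size p').+1 by lia.
apply: kmin; apply/existsP; exists (in_tuple (u :: p')).
(* A path of one step would be the edge uv itself, which is avoided. *)
have s2 : 1 < size p'.
  case: p' up' p'v {uq' sp' pp} => [_ /= E|a [|//]].
    by rewrite E adj_irrefl in uv.
  by rewrite /= andbT => + E; rewrite E /avoid eqxx andbF.
apply/andP; split.
  apply/and3P; split=> //.
  by rewrite /= rcons_path p'v adj_sym uv (sub_path (@avoid_sub G _) up').
apply/hasP; exists v; first by rewrite -p'v mem_last.
have -> : next (u :: p') v = u.
  by rewrite -p'v next_nth mem_last index_last // nth_default.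
by rewrite ve.
Qed.

Lemma gen2P (G : sgraph) (l : nat) (x y z : G) : x != y -> y != z ->
  eadd (dist x y) (dist y z) = Some l ->
  exists2 g : gen G 2 l, val g = [tuple x; y; z] &
    smooth (val g) 1 = (dist x z == Some l).
Proof.
move=> xy yz d.
have gP : is_chain l [tuple x; y; z].
  by rewrite /is_chain /= xy yz /= -d; case: (dist y z) => [j|]; rewrite /= ?addn0.
exists (Sub [tuple x; y; z] gP) => //.
by rewrite /smooth !(tnth_nth x) !inordK //= d.
Qed.

Section Geodesic.
Variables (G : sgraph) (u v : G) (N : nat).
Let r := avoid [set u; v].
Hypothesis girth : forall m, walk r m u v -> N <= m.

Let rC : symmetric r := avoid_sym _.
Let adjC m x y : walk r m x y -> walk (@adj G) m x y := walk_sub (@avoid_sub G _).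

(* A geodesic of G shorter than the given path would have to use the edge uv,
   and its part avoiding uv would still shorten a path from u to v. *)
Lemma dist_on_path i j b : i + j = N -> walk r i u b -> walk r j b v ->
  (i <= j.+1 -> dist u b = Some i) /\ (j <= i.+1 -> dist v b = Some j).
Proof.
move=> ijN ub bv; split=> ij.
  have [a dub ai] := walk_dist (adjC ub); rewrite dub; congr Some.
  have [H|[c ca [H|H]]] := walk_avoid u v (dist_walk dub).
  - have := girth (walk_cat H bv); lia.
  - have := girth (walk_cat H bv); lia.
  - have := girth (walk_cat ub (walk_sym rC H)); lia.
have [a dvb aj] := walk_dist (walk_sym (@adj_sym G) (adjC bv)); rewrite dvb; congr Some.
have [H|[c ca [H|H]]] := walk_avoid u v (dist_walk dvb).
- have := girth (walk_cat ub (walk_sym rC H)); lia.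
- have := girth (walk_cat H bv); lia.
- have := girth (walk_cat ub (walk_sym rC H)); lia.
Qed.

End Geodesic.

(** * The functional on 2-chains and the nonzero class *)

Definition beyond_chain (G : sgraph) (u v b : G) n (s : seq G) : bool :=
  if s is [:: x; y; z] then [&& x == u, z == b & beyond u v n b y] else false.

Lemma beyond_chain_smooth (G : sgraph) (u v b : G) (n m : nat) (x : gen G 3 n.+1) :
  adj u v -> (forall m, walk (avoid [set u; v]) m u v -> 2 * n <= m) ->
  dist v b = Some n -> dist u b = Some m -> n <= m ->
  let P := beyond_chain u v b n in
  smooth (val x) 1 && P (delete 1 (val x)) = smooth (val x) 2 && P (delete 2 (val x)).
Proof.
move=> uv girth vb ub nm /=; case: x => [[[|a [|y [|w [|c [|]]]]] //= sx]].
rewrite /is_chain /smooth /= andbT => /andP[/and3P[aNy yNw wNc] /eqP xl].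
rewrite !(tnth_nth a) !inordK //=.
case: (a =P u) => [au|]; last by rewrite !andbF.
case: (c =P b) => [cb|]; last by rewrite !andbF.
subst a c; rewrite /= (beyond_smooth uv girth vb ub nm) //.
by move: xl; case: (dist w b) => //= d; rewrite addn0.
Qed.

Theorem theorem1p5 (G : sgraph) (e : {set G}) (he : e \in edges G) (k : nat)
    (hk : local_girth e = Some k) (hk5 : (5 <= k)%N) :
  exists h : MH G 2 (k.+1 %/ 2), h <> 0%R.
Proof.
have [u [v [-> uv path_uv girth]]] := local_girthP hk.
set n := k.-1 %/ 2.
have -> : k.+1 %/ 2 = n.+1 by rewrite /n; lia.
have n0 : 0 < n by rewrite /n; lia.
(* A bound common to both parities: k - 1 is 2n or 2n + 1. *)
have girth2 m : walk (avoid [set u; v]) m u v -> 2 * n <= m.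
  by move/girth; rewrite /n; lia.
have uNv : u != v by apply: contraTneq uv => ->; rewrite adj_irrefl.
have duv := dist_adj uv.
have [i iE] : exists i, k.-1 = i + n by exists (k.-1 - n); rewrite /n; lia.
rewrite iE in path_uv girth.
have iP : i = n \/ i = n.+1 by rewrite /n in iE *; lia.
have [b ub bv] := walk_split path_uv.
have [dub dvb] := dist_on_path girth erefl ub bv.
have {dub}dub : dist u b = Some i by apply: dub; lia.
have {dvb}dvb : dist v b = Some n by apply: dvb; lia.
have vNb : v != b by rewrite -dist_eq0 dvb; case: (n) n0.
have [g gE gs] : exists2 g : gen G 2 n.+1, val g = [tuple u; v; b] &
    smooth (val g) 1 = (dist u b == Some n.+1) by apply: gen2P; rewrite // duv dvb.
pose P := beyond_chain u v b n.
have HP (x : gen G 3 n.+1) : smooth (val x) 1 && P (delete 1 (val x)) =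
                             smooth (val x) 2 && P (delete 2 (val x)).
  by apply: beyond_chain_smooth uv girth2 dvb dub _; lia.
have Pg : P (val g).
  by rewrite gE /P /= /beyond !eqxx vNb duv distxx dvb /= eqxx.
case: iP => iE'; subst i.
  (* Since d(u, b) = n differs from n + 1, deleting [v] is not allowed and (u, v, b) has zero
     boundary. *)
  apply: (MH2_neq0 (P := P) (z := basis 2 n.+1 (val g)) HP).
    rewrite boundary_basis boundary_gen2 gs dub ifN //.
    by rewrite -[_ == _]/(n == n.+1); lia.
  by rewrite coef_sum_basis Pg.
have [x ux xb] := walk_split (ub : walk _ (1 + n) u b).
(* Otherwise a walk of length at most 1 from [u] to [v] would avoid the edge uv. *)
have xNv : v != x by apply/eqP=> E; move: ux; rewrite -E => /girth; lia.
have [a dux a1] := walk_dist (walk_sub (@avoid_sub G _) ux).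
have [c dxb cn] := walk_dist (walk_sub (@avoid_sub G _) xb).
have [j] := dist_triangle dux dxb; rewrite dub => -[<-{j}] ac.
have [? ?] : a = 1 /\ c = n by lia.
subst a c.
have uNx : u != x by rewrite -dist_eq0 dux.
have xNb : x != b by rewrite -dist_eq0 dxb; case: (n) n0.
have [g' gE' gs'] : exists2 g : gen G 2 n.+1, val g = [tuple u; x; b] &
    smooth (val g) 1 = (dist u b == Some n.+1) by apply: gen2P; rewrite // dux dxb.
(* As d(u, x) = 1, being counted would require d(v, x) = 0. *)
have Pg' : P (val g') = false.
  rewrite gE' /P /= /beyond !eqxx xNb dux /=.
  case E: (dist v x) => [[|j]|] //=.
  by move/eqP: E; rewrite dist_eq0 (negbTE xNv).
apply: (MH2_neq0 (P := P)
  (z := (basis 2 n.+1 (val g) - basis 2 n.+1 (val g'))%R) HP).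
  by rewrite raddfB /= !boundary_basis !boundary_gen2 gs gs' dub eqxx gE gE' subrr.
by rewrite raddfB /= !coef_sum_basis Pg Pg'.
Qed.
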